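(* Let $R$ be a ring, $M$ an $R$-module and $\phi:S(M)\to S(M)\cup\{\emptyset\}$ a function. If $N$ is a $\phi$-classical prime submodule of $M$ that is not a classical prime submodule, then $(N:_R M)^2N\subseteq\phi(N)$.
   Context: All rings are commutative with nonzero identity and all modules are unitary. $S(M)$ is the set of all submodules of $M$. Standing convention: $\phi(N)\subseteq N$ for every $N\in S(M)$. A proper submodule $N$ of $M$ is $\phi$-classical prime if whenever $a,b\in R$ and $m\in M$ with $abm\in N\setminus\phi(N)$, then $am\in N$ or $bm\in N$; it is classical prime if whenever $a,b\in R$ and $m\in M$ with $abm\in N$, then $am\in N$ or $bm\in N$. $(N:_R M)=\{r\in R\mid rM\subseteq N\}$. *)

(* Defs.v *)
From HB Require Import structures.
From mathcomp Require Import all_boot all_algebra.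
From mathcomp Require Import boolp classical_sets.

Set Implicit Arguments.
Unset Strict Implicit.
Unset Printing Implicit Defensive.

Import GRing.Theory.
Local Open Scope classical_set_scope.
Local Open Scope ring_scope.

(* By proof irrelevance, a submodule is determined by its underlying set, so a
   function on [submodule M] is a function on the set S(M). *)
Record submodule (R : comNzRingType) (M : lmodType R) := Submodule {
  submodule_set :> set M;
  submoduleP : GRing.submod_closed [in submodule_set]
}.

Canonical submodule_predType (R : comNzRingType) (M : lmodType R) :=
  @PredType M (submodule M) (fun N => in_set N).

(* An element of [option (submodule M)] encodes an element of S(M) together
   with the empty set, the latter being [None]. *)
Definition osubset (R : comNzRingType) (M : lmodType R)
    (o : option (submodule M)) : set M :=
  if o is Some L then L : set M else set0.

Definition classical_prime (R : comNzRingType) (M : lmodType R)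
    (N : submodule M) : Prop :=
  (N : set M) <> [set: M] /\
  forall (a b : R) (m : M), (a * b) *: m \in N -> a *: m \in N \/ b *: m \in N.

Definition phi_classical_prime (R : comNzRingType) (M : lmodType R)
    (phi : submodule M -> option (submodule M)) (N : submodule M) : Prop :=
  (N : set M) <> [set: M] /\
  forall (a b : R) (m : M),
    (a * b) *: m \in (N : set M) `\` osubset (phi N) ->
    a *: m \in N \/ b *: m \in N.

Definition residual (R : comNzRingType) (M : lmodType R) (N : submodule M) :
    set R :=
  [set r | forall m : M, r *: m \in N].

(* All finite sums of products; when I is an ideal and A a submodule this is
   the submodule IA.  The product of two ideals is the case M = R^o. *)
Definition iprod (R : comNzRingType) (M : lmodType R)
    (I : set R) (A : set M) : set M :=
  [set x | exists (n : nat) (r : 'I_n -> R) (y : 'I_n -> M),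
     (forall i, r i \in I /\ y i \in A) /\ x = \sum_(i < n) r i *: y i].

Definition ideal_sqr (R : comNzRingType) (I : set R) : set R :=
  @iprod R R^o I I.

(* Main.v *)
(** Take [(a * b) *: m \in N] with [a *: m], [b *: m] outside [N].  For [s], [t]
    in [(N : M)] and [n] in [N], the shifted triple [a + s], [b + t], [m + n] is
    again a failure of classical primeness, because the shifts change
    [a *: m], [b *: m] and [(a * b) *: m] only by elements of [N].  Hence
    [((a + s) * (b + t)) *: (m + n)] always lies in [phi N]; taking differences
    with the values at [n = 0], [t = 0] and [s = 0] leaves [(s * t) *: n]. *)

Require Import Defs.
From HB Require Import structures.
From mathcomp Require Import all_boot all_algebra.
From mathcomp Require Import boolp classical_sets.

Set Implicit Arguments.
Unset Strict Implicit.
Unset Printing Implicit Defensive.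

Local Open Scope classical_set_scope.
Local Open Scope ring_scope.

Import GRing.Theory.

Section SubmoduleClosure.
Variables (R : comNzRingType) (M : lmodType R) (L : submodule M).

Lemma submodule0 : 0 \in L.
Proof. by case: (submoduleP L). Qed.

Lemma submoduleZD (r : R) (u v : M) : u \in L -> v \in L -> r *: u + v \in L.
Proof. by case: (submoduleP L) => _; apply. Qed.

Lemma submoduleD (u v : M) : u \in L -> v \in L -> u + v \in L.
Proof. by move=> Lu Lv; rewrite -[u]scale1r; apply: submoduleZD. Qed.

Lemma submoduleZ (r : R) (u : M) : u \in L -> r *: u \in L.
Proof.
by move=> Lu; rewrite -[_ *: _]addr0; apply: submoduleZD; last exact: submodule0.
Qed.

Lemma submoduleB (u v : M) : u \in L -> v \in L -> u - v \in L.
Proof. by move=> Lu Lv; rewrite addrC -scaleN1r; apply: submoduleZD. Qed.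

Lemma submoduleDr (u v : M) : v \in L -> u + v \in L -> u \in L.
Proof. by move=> Lv Luv; rewrite -[u](addrK v); apply: submoduleB. Qed.

Lemma submodule_sum (n : nat) (f : 'I_n -> M) :
  (forall i, f i \in L) -> \sum_(i < n) f i \in L.
Proof.
move=> Lf; apply: (big_ind (fun x => x \in L)) => //; first exact: submodule0.
exact: submoduleD.
Qed.

Lemma residual0 : residual L 0.
Proof. by move=> m; rewrite scale0r; apply: submodule0. Qed.

(** The difference of [(r + s) *: (m + n)] and [r *: m] is [r *: n + s *: (m + n)], whose two terms
    lie in [L]. In contrapositive form, shifts preserve non-membership. *)
Lemma submodule_shiftE (r s : R) (m n : M) :
  residual L s -> n \in L -> (r + s) *: (m + n) \in L -> r *: m \in L.
Proof.
move=> Ls Ln; rewrite scalerDl scalerDr -addrA; apply: submoduleDr.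
by apply: submoduleD; [apply: submoduleZ | apply: Ls].
Qed.

End SubmoduleClosure.

(** As [N] is proper, classical primeness can only fail through some concrete triple, extracted by
    classical logic. *)
Lemma not_classical_prime_witness (R : comNzRingType) (M : lmodType R)
    (N : submodule M) :
  (N : set M) <> [set: M] -> ~ classical_prime N ->
  exists (a b : R) (m : M),
    [/\ (a * b) *: m \in N, a *: m \notin N & b *: m \notin N].
Proof.
move=> Nproper Nncp; apply: contrapT => noabm; apply: Nncp; split=> // a b m Nabm.
have [|Nam] := boolP (a *: m \in N); first by left.
have [|Nbm] := boolP (b *: m \in N); first by right.
by case: noabm; exists a, b, m.
Qed.

Lemma phi_classical_prime_shift (R : comNzRingType) (M : lmodType R)
    (phi : submodule M -> option (submodule M)) (N : submodule M)
    (a b s t : R) (m n : M) :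
  phi_classical_prime phi N ->
  (a * b) *: m \in N -> a *: m \notin N -> b *: m \notin N ->
  residual N s -> residual N t -> n \in N ->
  osubset (phi N) (((a + s) * (b + t)) *: (m + n)).
Proof.
move=> [_ Np] Nabm Nam Nbm Ns Nt Nn; apply: contrapT => nphi.
have Nabmn : ((a + s) * (b + t)) *: (m + n) \in N.
  (* The terms are grouped so that each lies in [N] for its own reason: [Nabm], then [n \in N], then
     [t] and [s] sending all of [M] into [N]. *)
  have -> : ((a + s) * (b + t)) *: (m + n) =
      (a * b) *: m + ((a * b) *: n + (a *: (t *: (m + n))
        + s *: ((b + t) *: (m + n)))).
    by rewrite !scalerA mulrDl mulrDr !scalerDl !scalerDr !addrA.
  apply: submoduleD => //; apply: submoduleD; first exact: submoduleZ.
  by apply: submoduleD; [apply: submoduleZ; apply: Nt | apply: Ns].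
have [||] := Np (a + s) (b + t) (m + n).
- by rewrite inE; split=> //; move: Nabmn; rewrite inE.
- by move=> /(submodule_shiftE Ns Nn); apply/negP.
- by move=> /(submodule_shiftE Nt Nn); apply/negP.
Qed.

Theorem theorem2p30 (R : comNzRingType) (M : lmodType R)
    (phi : submodule M -> option (submodule M))
    (phi_sub : forall L : submodule M, osubset (phi L) `<=` (L : set M))
    (N : submodule M) :
  phi_classical_prime phi N ->
  ~ classical_prime N ->
  iprod (ideal_sqr (residual N)) (N : set M) `<=` osubset (phi N).
Proof.
move=> Np Nncp.
have [a [b [m [Nabm Nam Nbm]]]] := not_classical_prime_witness Np.1 Nncp.
have shift s t n : residual N s -> residual N t -> n \in N ->
    osubset (phi N) (((a + s) * (b + t)) *: (m + n)).
  exact: phi_classical_prime_shift.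
have N0 := submodule0 N; have r0 := residual0 N.
(* The empty value of [phi N] is excluded because the unshifted triple already gives it an
   element. *)
case: (phi N) shift => [P|] shift; last by case: (shift 0 0 0).
have {}shift s t n : residual N s -> residual N t -> n \in N ->
    ((a + s) * (b + t)) *: (m + n) \in P.
  by move=> *; apply/mem_set/shift.
(* Three differences inside the submodule [P] now remove [m], [b] and [a] in turn. *)
have Pabn s t n : residual N s -> residual N t -> n \in N ->
    ((a + s) * (b + t)) *: n \in P.
  move=> Ns Nt Nn; have := submoduleB (shift s t n Ns Nt Nn) (shift s t 0 Ns Nt N0).
  by rewrite -scalerBr addr0 (addrC m) addrK.
have Patn s t n : residual N s -> residual N t -> n \in N ->
    ((a + s) * t) *: n \in P.
  move=> Ns Nt Nn; have := submoduleB (Pabn s t n Ns Nt Nn) (Pabn s 0 n Ns r0 Nn).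
  by rewrite -scalerBl -mulrBr addr0 (addrC b) addrK.
have Pstn s t n : residual N s -> residual N t -> n \in N -> (s * t) *: n \in P.
  move=> Ns Nt Nn; have := submoduleB (Patn s t n Ns Nt Nn) (Patn 0 t n r0 Nt Nn).
  by rewrite -scalerBl -mulrBl addr0 (addrC a) addrK.
(* Each coefficient [r i] is itself a finite sum of products [s j * t j], so distributing it over
   [y i] leaves only terms covered by [Pstn]. *)
move=> _ [k [r [y [ryN ->]]]]; apply/set_mem/submodule_sum => i.
have [/set_mem[l [s [t [stN ->]]]] Ny] := ryN i.
rewrite scaler_suml; apply: submodule_sum => j.
by have [/set_mem Ns /set_mem Nt] := stN j; apply: Pstn.
Qed.
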